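(* Let $\theta\in\Theta_n$ and suppose $P_\theta\Pi_n(\{\theta\}\mid X^n)\ge1-x_n$, where $0<x_n<1$. Let $\gamma_n\in(0,1)$ and let $D_n(X^n)$ be a $1-\gamma_n$ credible set, i.e. $\Pi_n(D_n(X^n)\mid X^n)\ge1-\gamma_n$. Then $$P_\theta(\theta\in D_n(X^n))\ge1-\frac1{1-\gamma_n}x_n.$$
   Context: Parameter space: for an integer $0\le m<n/2$, $\Theta_{n,m}=\{\theta\in\{0,1\}^n:\sum_{i=1}^n\theta_i=m\}$; if $n$ is even, $\Theta_{n,n/2}=\{\theta\in\{0,1\}^n:\sum_{i=1}^n\theta_i=n/2,\ \theta_1=0\}$; and $\Theta_n=\bigcup_{m=0}^{\lfloor n/2\rfloor}\Theta_{n,m}$. Model (planted bi-section model): $p_n,q_n\in(0,1)$. $X^n$ is a random undirected graph without loops on vertex set $\{1,\ldots,n\}$, with values in the finite set $\mathscr X_n$ of such graphs and edge indicators $X_{ij}\in\{0,1\}$, $i<j$. Under $P_\theta$, $\theta\in\Theta_n$, the $X_{ij}$ ($i<j$) are independent with $P_\theta(X_{ij}=1)=Q_{i,j}(\theta)$, where $Q_{i,j}(\theta)=p_n$ if $\theta_i=\theta_j$ and $Q_{i,j}(\theta)=q_n$ if $\theta_i\ne\theta_j$. The likelihood is $p_\theta(X^n)=\prod_{i<j}Q_{i,j}(\theta)^{X_{ij}}(1-Q_{i,j}(\theta))^{1-X_{ij}}$. Posterior: the prior is a probability mass function $\pi_n$ on $\Theta_n$ with $\pi_n(\eta)>0$ for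 all $\eta\in\Theta_n$, and for $S\subseteq\Theta_n$, $\Pi_n(S\mid X^n)=\sum_{\theta\in S}\pi_n(\theta)p_\theta(X^n)\big/\sum_{\theta\in\Theta_n}\pi_n(\theta)p_\theta(X^n)$. For a real-valued function $f$ of $X^n$, $P_\theta f(X^n)$ denotes its expectation when $X^n\sim P_\theta$. A credible set of credible level $1-\gamma_n$ is a set-valued map $x^n\mapsto D_n(x^n)\subseteq\Theta_n$ with $\Pi_n(D_n(x^n)\mid x^n)\ge1-\gamma_n$ for every $x^n\in\mathscr X_n$. *)

(* Defs.v *)
From HB Require Import structures.
From mathcomp Require Import all_boot all_order all_algebra.
From mathcomp Require Import reals.

Set Implicit Arguments.
Unset Strict Implicit.
Unset Printing Implicit Defensive.

Import Order.TTheory GRing.Theory Num.Theory.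
Local Open Scope ring_scope.

(* Class assignments, i.e. {0,1}^n; the coordinates, like the vertices below,
   are numbered 0, ..., n - 1 instead of 1, ..., n. *)
Definition labels (n : nat) : finType := {ffun 'I_n -> bool}.

(* The condition on the first coordinate in the balanced case is vacuous for
   n = 0. *)
Definition Theta_m (n m : nat) : {set labels n} :=
  if (m.*2 < n)%N then [set t : labels n | (\sum_(i < n) t i)%N == m]
  else if (m.*2 == n)%N then
    [set t : labels n | ((\sum_(i < n) t i)%N == m)
                        && [forall i : 'I_n, (i == 0%N :> nat) ==> ~~ t i]]
  else set0.

Definition Theta (n : nat) : {set labels n} :=
  \bigcup_(m < n./2.+1) Theta_m n m.

(* Undirected graphs without loops, as sets of two-element sets of vertices. *)
Definition sgraph (n : nat) : finType :=
  {E : {set {set 'I_n}} | [forall e in E, #|e| == 2]}.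

Definition edge (n : nat) (X : sgraph n) (i j : 'I_n) : bool :=
  [set i; j] \in val X.

Section Model.
Variables (R : realType) (n : nat) (p q : R).

Definition edge_prob (t : labels n) (i j : 'I_n) : R :=
  if t i == t j then p else q.

Definition likelihood (t : labels n) (X : sgraph n) : R :=
  \prod_(i < n) \prod_(j < n | (i < j)%N)
    (edge_prob t i j ^+ edge X i j
     * (1 - edge_prob t i j) ^+ (1 - edge X i j)%N).

(* The law P_t of X is given by its probability mass function, which is the
   likelihood. *)
Definition Pr (t : labels n) (A : pred (sgraph n)) : R :=
  \sum_(X | A X) likelihood t X.

Definition expect (t : labels n) (f : sgraph n -> R) : R :=
  \sum_X likelihood t X * f X.

(* Only the values of pr on Theta n matter. *)
Definition full_prior (pr : labels n -> R) : Prop :=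
  (forall t, t \in Theta n -> 0 < pr t) /\ \sum_(t in Theta n) pr t = 1.

(* Meant for S \subset Theta n. *)
Definition posterior (pr : labels n -> R) (S : {set labels n}) (X : sgraph n)
    : R :=
  (\sum_(t in S) pr t * likelihood t X)
  / (\sum_(t in Theta n) pr t * likelihood t X).

Definition credible_set (pr : labels n -> R) (level : R)
    (D : sgraph n -> {set labels n}) : Prop :=
  forall X, D X \subset Theta n /\ level <= posterior pr (D X) X.

End Model.

(* Main.v *)
Require Import Defs.
From mathcomp Require Import all_boot all_order all_algebra.
From mathcomp Require Import reals.
From mathcomp Require Import zify lra.

Import Order.TTheory GRing.Theory Num.Theory.
Local Open Scope ring_scope.

(** The credible level enters only through one pointwise bound. If [D X] misses
    [t], then [D X] and [[set t]] are disjoint, so their posterior masses add up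
    to at most 1 and the posterior mass of [t] is at most [gamma]
    ([posterior_notin_credible]). Whatever [X] is, that mass is therefore at most
    [gamma + (1 - gamma) * (t \in D X)%:R].

    Taking expectations under the law of [t], with [a] the probability that [D X]
    covers [t], gives [1 - x <= gamma + (1 - gamma) * a], which rearranges to the
    claim. Bounding the expectation of the constant [gamma] requires the
    likelihood to have total mass 1 ([sum_likelihood]): it is a product of
    independent Bernoulli weights over the possible edges, and summing over all
    graphs expands [\prod_e (w e + (1 - w e)) = 1]. *)

(** The edges are parametrised in the likelihood by pairs [i < j], but in a graph
    by two-element sets; unordered products need the latter. *)
Lemma prod_ltn_pairs (R : comPzRingType) (n : nat) (F : {set 'I_n} -> R) :
  \prod_(i < n) \prod_(j < n | (i < j)%N) F [set i; j] =
  \prod_(e : {set 'I_n} | #|e| == 2) F e.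
Proof.
rewrite pair_big_dep /=.
pose P := [set u : 'I_n * 'I_n | (u.1 < u.2)%N].
pose h (u : 'I_n * 'I_n) := [set u.1; u.2].
rewrite (eq_bigl (mem P)) => [|u]; last by rewrite !inE.
have h_inj : {in P &, injective h}.
  move=> [i j] [k l]; rewrite !inE /h /= => lt_ij lt_kl eq_h.
  have : i \in [set k; l] by rewrite -eq_h set21.
  have : j \in [set k; l] by rewrite -eq_h set22.
  have : k \in [set i; j] by rewrite eq_h set21.
  rewrite !inE -!val_eqE /= => hk hj hi.
  by congr (_, _); apply: val_inj => /=; lia.
rewrite -(big_imset _ h_inj); apply: eq_bigl => e.
apply/imsetP/idP => [[[i j]]|/cards2P[i [j [neq_ij ->]]]].
  by rewrite inE /h /= => lt_ij ->; rewrite cards2 -val_eqE (ltn_eqF lt_ij).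
case: (ltngtP i j) => [lt_ij|lt_ji|/val_inj eq_ij].
- by exists (i, j); rewrite ?inE.
- by exists (j, i); rewrite ?inE // /h setUC.
- by rewrite eq_ij eqxx in neq_ij.
Qed.

Section Model.
Context {R : realType} {n : nat} (p q : R).
Implicit Types (t : labels n) (X : sgraph n) (e : {set 'I_n}).

(** [edge_prob] seen on two-element sets: the endpoints of [e] have the same
    label exactly when the labels form a singleton. *)
Definition edge_weight t e : R := if #|t @: e| == 1 then p else q.

Lemma likelihoodE t X :
  likelihood p q t X =
  \prod_(e : {set 'I_n} | #|e| == 2)
    (if e \in val X then edge_weight t e else 1 - edge_weight t e).
Proof.
rewrite -prod_ltn_pairs; apply: eq_bigr => i _; apply: eq_bigr => j _.
have -> : edge_weight t [set i; j] = edge_prob p q t i j.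
  by rewrite /edge_weight /edge_prob imsetU1 imset_set1 cards2; case: (t i == t j).
by rewrite /edge; case: ifP; rewrite /= !(expr0, expr1, mul1r, mulr1).
Qed.

Lemma sum_likelihood t : \sum_X likelihood p q t X = 1.
Proof.
pose w := edge_weight t.
(* [bigA_distr] sums over all families of subsets, so that a set which is not a
   possible edge gets probability 0, and every family containing it vanishes. *)
pose F e := if #|e| == 2 then w e else 0.
pose G e := if #|e| == 2 then 1 - w e else 1.
have : \prod_e (F e + G e) = 1.
  rewrite big1 // => e _; rewrite /F /G.
  by case: ifP => _; rewrite ?add0r // subrKC.
rewrite bigA_distr => <-.
rewrite (bigID (fun E : {set {set 'I_n}} => [forall e in E, #|e| == 2])) /=.
rewrite [X in _ + X]big1 ?addr0 => [|E /forallPn[e]]; last first.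
  rewrite negb_imply => /andP[eE /negPf ne2].
  by rewrite (bigD1 e) //= eE /F ne2 mul0r.
rewrite [RHS](big_sub (fun E : {set {set 'I_n}} => [forall e in E, #|e| == 2])).
apply: eq_bigr => X _; rewrite likelihoodE [LHS]big_mkcond.
apply: eq_bigr => e _; rewrite /F /G; case: ifP => // ne2; case: ifP => // eX.
by have /forallP/(_ e) := valP X; rewrite eX ne2.
Qed.

Hypotheses (hp : 0 < p < 1) (hq : 0 < q < 1).

Lemma likelihood_gt0 t X : 0 < likelihood p q t X.
Proof.
rewrite likelihoodE; apply: prodr_gt0 => e _; rewrite /edge_weight.
by case: ifP; case: ifP => _ _; rewrite ?subr_gt0;
  move/andP: hp hq => [? ?] /andP[].
Qed.

Variables (pr : labels n -> R) (hpr : full_prior pr).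

Lemma posterior_notin_credible gamma (D : sgraph n -> {set labels n}) t X :
    credible_set p q pr (1 - gamma) D -> t \in Theta n -> t \notin D X ->
  posterior p q pr [set t] X <= gamma.
Proof.
move=> /(_ X)[DTheta credD] tTheta tND.
suff : posterior p q pr [set t] X + posterior p q pr (D X) X <= 1 by lra.
have joint_gt0 s : s \in Theta n -> 0 < pr s * likelihood p q s X.
  by move=> sTheta; rewrite mulr_gt0 ?likelihood_gt0 ?hpr.1.
rewrite /posterior -mulrDl big_set1 ler_pdivrMr ?mul1r; last first.
  rewrite (bigD1 t) //= ltr_pwDl ?joint_gt0 // sumr_ge0 // => s /andP[sTheta _].
  exact/ltW/joint_gt0.
rewrite -big_setU1 //= [leRHS](big_setID (t |: D X)) /=.
have /setIidPr -> : t |: D X \subset Theta n by rewrite subUset sub1set tTheta.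
by rewrite lerDl sumr_ge0 // => s /setDP[sTheta _]; exact/ltW/joint_gt0.
Qed.

Lemma posterior_set1_le1 t X :
  t \in Theta n -> posterior p q pr [set t] X <= 1.
Proof.
move=> tTheta.
(* The empty set is a credible set of level 1 - 1 = 0. *)
apply: (@posterior_notin_credible 1 (fun=> set0)); rewrite ?inE //.
by move=> Y; rewrite sub0set subrr /posterior big_set0 mul0r.
Qed.

End Model.

Theorem lemma5p1 (R : realType) (n : nat) (p q : R)
    (hp : 0 < p < 1) (hq : 0 < q < 1)
    (pr : labels n -> R) (hpr : full_prior pr)
    (t : labels n) (ht : t \in Theta n)
    (x : R) (hx : 0 < x < 1)
    (hpost : 1 - x <= expect p q t (posterior p q pr [set t]))
    (gamma : R) (hgamma : 0 < gamma < 1)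
    (D : sgraph n -> {set labels n})
    (hD : credible_set p q pr (1 - gamma) D) :
  1 - 1 / (1 - gamma) * x <= Pr p q t (fun X => t \in D X).
Proof.
have g_lt1 : 0 < 1 - gamma by lra.
set a := Pr _ _ _ _.
suff : 1 - x <= gamma + (1 - gamma) * a.
  move=> le_a; rewrite -(ler_pM2l g_lt1) mulrBr mulrA mulrCA mulfV ?gt_eqF //.
  lra.
apply: le_trans hpost _.
rewrite -[leRHS](_ : \sum_X likelihood p q t X
                       * (gamma + (1 - gamma) * (t \in D X)%:R) = _).
  apply: ler_sum => X _; rewrite ler_pM2l ?likelihood_gt0 //.
  case: (boolP (t \in D X)) => tD.
    by rewrite mulr1 subrKC posterior_set1_le1.
  by rewrite mulr0 addr0 (posterior_notin_credible _ _ hp hq _ hpr _ _ _ _ hD).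
under eq_bigr do rewrite mulrDr mulrCA.
rewrite big_split -mulr_suml sum_likelihood mul1r -mulr_sumr /=; congr (_ + _ * _).
by rewrite /a /Pr [RHS]big_mkcond; apply: eq_bigr => X _; rewrite mulr_natr mulrb.
Qed.
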